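(* Let $S$ be a (not necessarily commutative) bipotent semiring with elements of unbounded multiplicative order, that is, such that for all $k \in \mathbb{N}$ there exists $x \in S$ of multiplicative order greater than $k$. Then the semigroups $M_n(S)$ and $UT_n(S)$ are not strongly permutable for all $n \geq 2$. Moreover, for $n \in \mathbb{N}$, the semigroup $U_n(S)$ is not strongly permutable if and only if $n \geq 3$.
   Context: $\mathbb{N}$ denotes the natural numbers excluding $0$. A semiring is a non-empty set with two associative binary operations (addition and multiplication), with addition commutative and multiplication distributing over addition on both sides; no zero or identity element is required. It is bipotent if $x+y\in\{x,y\}$ for all $x,y$. The multiplicative order of $x \in S$ is the cardinality (possibly infinite) of the set of positive powers of $x$. A zero of a semiring is an element that is both a multiplicative zero and an additive identity. $S^0$ denotes $S$ itself if $S$ has a zero (then denoted $0$), and otherwise $S\cup\{0\}$ with $0$ a new element acting as a zero. $S^1$ denotes $S$ if $S$ has a multiplicative identity (then denoted $1$), and otherwise $S\cup\{1\}$ with a new symbol $1$ satisfying $1x=x1=x$ for all $x$, $1+1=1$, and (where $S$ has a zero) $1+0=0+1=1$, other sums involving $1$ being undefined. $S^{01}=(S^0)^1$. $M_n(S)$ is the semigroup of all $n\times n$ matrices over $S$ under matrix multiplication. $UT_n(S)$ is the subsemigroup of $M_n(S^0)$ of matrices with $0$ below the main diagonal and elements of $S$ on and above the main diagonal. $U_n(S)$ is the semigroup under matrix multiplication of $n\times n$ matrices over $S^{01}$ with $0$ below the main diagonal, $1$ on the main diagonal and elements of $S$ above the main diagonal (all sums needed for the products are defined). A semigroup $T$ is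 strongly permutable (or permutable) if there exists $k\geq 2$ such that for all $s_1,\dots,s_k\in T$ there is a non-identity permutation $\sigma$ of $\{1,\dots,k\}$ with $s_{\sigma(1)}\cdots s_{\sigma(k)}=s_1\cdots s_k$. *)

(* Defs.v *)
From HB Require Import structures.
From mathcomp Require Import all_boot all_fingroup.
From mathcomp Require Import ssralg matrix.
From mathcomp Require Import boolp classical_sets functions cardinality.

Set Implicit Arguments.
Unset Strict Implicit.
Unset Printing Implicit Defensive.

Local Open Scope classical_set_scope.
Local Open Scope card_scope.
Local Open Scope ring_scope.
Local Open Scope group_scope.

(* MathComp's own semirings all have a 0 and a 1.  Commutativity of the
   addition is part of addSemigroupType.  MathComp's algebraic structures sit
   on choiceType, which classically restricts nothing. *)
HB.mixin Record isBareSemiring S of Algebra.AddSemigroup S & Semigroup S := {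
  semiring_nonempty : [set: S] !=set0;
  smulDl : left_distributive (@monoid.mul S) (@Algebra.add S);
  smulDr : right_distributive (@monoid.mul S) (@Algebra.add S)
}.

#[short(type="bareSemiringType")]
HB.structure Definition BareSemiring :=
  {S of isBareSemiring S & Algebra.AddSemigroup S & Semigroup S}.

Definition bipotent (S : bareSemiringType) :=
  forall x y : S, (x + y)%R = x \/ (x + y)%R = y.

Definition positive_powers (T : semigroupType) (x : T) : set T :=
  [set iterop m.+1 (@monoid.mul T) x x | m in [set: nat]].

Definition mul_order_gt (T : semigroupType) (x : T) (k : nat) :=
  ~ (positive_powers x #<= `I_k).

Definition unbounded_mul_order (T : semigroupType) :=
  forall k : nat, (0 < k)%N -> exists x : T, mul_order_gt x k.

(* [x0] is only the (junk) value at the empty sequence. *)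
Definition fold1 (T : Type) (op : T -> T -> T) (x0 : T) (s : seq T) : T :=
  if s is x :: s' then foldl op x s' else x0.

Definition ord_prod (T : semigroupType) n (s : 'I_n.+1 -> T) : T :=
  fold1 (@monoid.mul T) (s ord0) [seq s i | i <- enum 'I_n.+1].

(* k.+2 ranges over the integers k >= 2. *)
Definition strongly_permutable (T : semigroupType) :=
  exists k : nat, forall s : 'I_k.+2 -> T,
    exists2 sigma : 'S_k.+2, sigma != 1 & ord_prod (s \o sigma) = ord_prod s.

Section Adjoin0.
Variable S : bareSemiringType.

Definition is_zero (z : S) :=
  forall x : S, [/\ z * x = z, x * z = z, (z + x)%R = x & (x + z)%R = x].

Definition withzero : Type := option S.
HB.instance Definition _ := Choice.on withzero.

Definition withzero_add (x y : withzero) : withzero :=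
  match x, y with
  | Some a, Some b => Some (a + b)%R
  | None, _ => y
  | _, None => x
  end.

Definition withzero_mul (x y : withzero) : withzero :=
  if (x, y) is (Some a, Some b) then Some (a * b) else None.

Lemma withzero_addC : commutative withzero_add.
Proof. by move=> [a|] [b|] //=; rewrite Algebra.addrC. Qed.

Lemma withzero_addA : associative withzero_add.
Proof. by move=> [a|] [b|] [c|] //=; rewrite Algebra.addrA. Qed.

Lemma withzero_mulA : associative withzero_mul.
Proof. by move=> [a|] [b|] [c|] //=; rewrite /withzero_mul mulgA. Qed.

HB.instance Definition _ :=
  Algebra.isAddSemigroup.Build withzero withzero_addC withzero_addA.
HB.instance Definition _ := isSemigroup.Build withzero withzero_mulA.

Lemma withzero_mulDl :
  left_distributive (@monoid.mul withzero) (@Algebra.add withzero).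
Proof. by move=> [a|] [b|] [c|] //=; congr Some; apply: smulDl. Qed.

Lemma withzero_mulDr :
  right_distributive (@monoid.mul withzero) (@Algebra.add withzero).
Proof. by move=> [a|] [b|] [c|] //=; congr Some; apply: smulDr. Qed.

HB.instance Definition _ :=
  isBareSemiring.Build withzero (ex_intro _ None I) withzero_mulDl withzero_mulDr.

Definition has_zero := exists z : S, is_zero z.

(* S^0 is S itself when S already has a zero.  The decision [p] is a
   parameter so that the carrier, the map S -> S^0 and the zero of S^0 all
   reduce when it is destructed. *)
Definition adjoin0_at (p : {has_zero} + {~ has_zero}) : bareSemiringType :=
  if p then S else withzero.

Definition inj0_at p : S -> adjoin0_at p :=
  if p is left _ then fun x : S => x else fun x : S => Some x : withzero.

Definition zero0_at p : adjoin0_at p :=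
  if p is left h then sval (cid h) else None : withzero.

Definition adjoin0 : bareSemiringType := adjoin0_at (pselect has_zero).
Definition inj0 : S -> adjoin0 := inj0_at (pselect has_zero).
Definition zero0 : adjoin0 := zero0_at (pselect has_zero).

Lemma inj0_inj : injective inj0.
Proof. by rewrite /inj0 /adjoin0; case: pselect => [h|h] x y //= []. Qed.

Lemma inj0D x y : inj0 (x + y)%R = (inj0 x + inj0 y)%R.
Proof. by rewrite /inj0 /adjoin0; case: pselect. Qed.

Lemma inj0M x y : inj0 (x * y) = inj0 x * inj0 y.
Proof. by rewrite /inj0 /adjoin0; case: pselect. Qed.

End Adjoin0.

Lemma zero0P (S : bareSemiringType) : is_zero (zero0 S).
Proof.
rewrite /zero0 /adjoin0; case: pselect => [h|h] /=; first by case: cid.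
by case.
Qed.

(* The addition of S^1 is partial: [None] stands for an undefined sum. *)
Section Adjoin1.
Variable S : bareSemiringType.

Definition is_one (e : S) := forall x : S, e * x = x /\ x * e = x.

Definition withone : Type := option S.
HB.instance Definition _ := Choice.on withone.

Definition withone_mul (x y : withone) : withone :=
  match x, y with
  | Some a, Some b => Some (a * b)
  | None, _ => y
  | _, None => x
  end.

Lemma withone_mulA : associative withone_mul.
Proof. by move=> [a|] [b|] [c|] //=; rewrite mulgA. Qed.

HB.instance Definition _ := isSemigroup.Build withone withone_mulA.

Definition withone_add (x y : withone) : option withone :=
  match x, y with
  | Some a, Some b => Some (Some (a + b)%R)
  | None, None => Some None
  | None, Some b => if `[< is_zero b >] then Some None else None
  | Some a, None => if `[< is_zero a >] then Some None else None
  end.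

Definition has_one := exists e : S, is_one e.

Definition adjoin1_at (p : {has_one} + {~ has_one}) : semigroupType :=
  if p then (S : semigroupType) else (withone : semigroupType).

Definition inj1_at p : S -> adjoin1_at p :=
  if p is left _ then fun x : S => x else fun x : S => Some x : withone.

Definition one1_at p : adjoin1_at p :=
  if p is left h then sval (cid h) else None : withone.

Definition add1_at p : adjoin1_at p -> adjoin1_at p -> option (adjoin1_at p) :=
  if p is left _ then fun x y : S => Some (x + y)%R else withone_add.

Definition adjoin1 : semigroupType := adjoin1_at (pselect has_one).
Definition inj1 : S -> adjoin1 := inj1_at (pselect has_one).
Definition one1 : adjoin1 := one1_at (pselect has_one).
Definition add1 : adjoin1 -> adjoin1 -> option adjoin1 :=
  add1_at (p := pselect has_one).

(* [None] as soon as one of the partial sums is undefined *)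
Definition sum1 (s : seq adjoin1) : option adjoin1 :=
  if s is x :: s' then foldl (fun o y => obind (add1^~ y) o) (Some x) s'
  else None.

Lemma inj1_inj : injective inj1.
Proof. by rewrite /inj1 /adjoin1; case: pselect => [h|h] x y //= []. Qed.

Lemma inj1M x y : inj1 (x * y) = inj1 x * inj1 y.
Proof. by rewrite /inj1 /adjoin1; case: pselect. Qed.

Lemma one1P (x : adjoin1) : one1 * x = x /\ x * one1 = x.
Proof.
rewrite /one1; move: x; rewrite /adjoin1.
case: pselect => [h|h] x /=; first by case: cid.
by case: x.
Qed.

Lemma add1_inj x y : add1 (inj1 x) (inj1 y) = Some (inj1 (x + y)%R).
Proof. by rewrite /inj1 /add1 /adjoin1; case: pselect. Qed.

Lemma add1_01 z : is_zero z ->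
  add1 (inj1 z) one1 = Some one1 /\ add1 one1 (inj1 z) = Some one1.
Proof.
move=> hz; rewrite /add1 /inj1 /one1 /adjoin1; case: pselect => [h|h] /=.
  by case: cid => e /= _; have [_ _ -> ->] := hz e.
by have -> : `[< is_zero z >] by apply/asboolP.
Qed.

End Adjoin1.

Section Sum0.
Variable S : bareSemiringType.
Local Notation Z := (adjoin0 S).

Definition add0 : Z -> Z -> Z := @Algebra.add Z.
Definition mul0 : Z -> Z -> Z := @monoid.mul Z.

Lemma add0A : associative add0. Proof. exact: Algebra.addrA. Qed.
Lemma add0C : commutative add0. Proof. exact: Algebra.addrC. Qed.
Lemma add0z : left_id (zero0 S) add0.
Proof. by move=> x; case: (zero0P x). Qed.
Lemma mul0z : left_zero (zero0 S) mul0.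
Proof. by move=> x; case: (zero0P x). Qed.
Lemma mulz0 : right_zero (zero0 S) mul0.
Proof. by move=> x; case: (zero0P x). Qed.
Lemma mul0Dl : left_distributive mul0 add0. Proof. exact: smulDl. Qed.
Lemma mul0Dr : right_distributive mul0 add0. Proof. exact: smulDr. Qed.

HB.instance Definition _ :=
  Monoid.isComLaw.Build Z (zero0 S) add0 add0A add0C add0z.
HB.instance Definition _ := Monoid.isMulLaw.Build Z (zero0 S) mul0 mul0z mulz0.
HB.instance Definition _ := Monoid.isAddLaw.Build Z mul0 add0 mul0Dl mul0Dr.

Lemma fold1_add0 (x0 : Z) (s : seq Z) : s != [::] ->
  fold1 (@Algebra.add Z) x0 s = \big[add0/zero0 S]_(x <- s) x.
Proof.
case: s => // x s _; rewrite big_cons /=.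
elim: s x => [|y s IHs] x /=; first by rewrite big_nil Monoid.mulm1.
by rewrite IHs big_cons Monoid.mulmA.
Qed.

Lemma fold1_ord n (i : 'I_n) (x0 : Z) (F : 'I_n -> Z) :
  fold1 (@Algebra.add Z) x0 [seq F k | k <- enum 'I_n] =
  \big[add0/zero0 S]_(k < n) F k.
Proof.
rewrite fold1_add0 ?big_map ?big_enum //.
by rewrite -size_eq0 size_map size_enum_ord; case: n i {F} => [[]|].
Qed.

Definition in_S (x : Z) := exists s : S, x = inj0 s.

Lemma in_S_mul x y : in_S x -> in_S y -> in_S (x * y).
Proof. by move=> [s ->] [t ->]; exists (s * t); rewrite inj0M. Qed.

Lemma in_S_add x y : in_S x -> in_S y \/ y = zero0 S -> in_S (add0 x y).
Proof.
move=> [s ->] [[t ->]|->]; first by exists (s + t)%R; rewrite inj0D.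
by exists s; rewrite Monoid.mulm1.
Qed.

Lemma in_S0_add x y : in_S x \/ x = zero0 S -> in_S y \/ y = zero0 S ->
  in_S (add0 x y) \/ add0 x y = zero0 S.
Proof.
move=> [hx|->] hy; first by left; apply: in_S_add.
by rewrite add0z.
Qed.

Lemma in_S0_mul x y : in_S x \/ x = zero0 S -> in_S y \/ y = zero0 S ->
  in_S (x * y) \/ x * y = zero0 S.
Proof.
move=> [hx|->]; last by right; apply: mul0z.
by move=> [hy|->]; [left; apply: in_S_mul | right; apply: mulz0].
Qed.

Lemma in_S0_sum n (P : pred 'I_n) (F : 'I_n -> Z) :
  (forall k, in_S (F k) \/ F k = zero0 S) ->
  in_S (\big[add0/zero0 S]_(k < n | P k) F k) \/
  \big[add0/zero0 S]_(k < n | P k) F k = zero0 S.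
Proof.
move=> hF; apply: (big_ind (fun x => in_S x \/ x = zero0 S)) => //.
- by right.
- exact: in_S0_add.
Qed.

End Sum0.

Section MatrixSemigroup.
Variables (S : bareSemiringType) (n : nat).

Definition Mn : Type := 'M[S]_n.
HB.instance Definition _ := Choice.on Mn.

(* The list summed contains the index [i], so it is never empty. *)
Definition Mn_mul (A B : Mn) : Mn :=
  \matrix_(i, j)
    fold1 (@Algebra.add S) (A i j) [seq A i k * B k j | k <- enum 'I_n].

Lemma inj0_Mn_mul (A B : Mn) i j : inj0 (Mn_mul A B i j) =
  \big[add0 (S := S)/zero0 S]_(k < n) (mul0 (inj0 (A i k)) (inj0 (B k j))).
Proof.
rewrite mxE -(fold1_ord i (inj0 (A i j))).
set F := fun k => A i k * B k j; set G := fun k => mul0 _ _.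
have -> : [seq G k | k <- enum 'I_n] =
          [seq inj0 x | x <- [seq F k | k <- enum 'I_n]].
  by rewrite -[RHS]map_comp; apply: eq_map => k; rewrite /= inj0M.
case: [seq F k | k <- enum 'I_n] => //= x s.
by elim: s x => //= y s IHs x; rewrite IHs inj0D.
Qed.

Lemma Mn_mulA : associative Mn_mul.
Proof.
move=> A B C; apply/matrixP => i j; apply: inj0_inj; rewrite !inj0_Mn_mul.
under eq_bigr do rewrite inj0_Mn_mul big_distrr /=.
rewrite exchange_big /=; apply: eq_bigr => k _.
rewrite inj0_Mn_mul big_distrl /=; apply: eq_bigr => l _.
exact: mulgA.
Qed.

HB.instance Definition _ := isSemigroup.Build Mn Mn_mulA.

End MatrixSemigroup.

Lemma Mn0_mulE (S : bareSemiringType) n (A B : Mn (adjoin0 S) n) i j :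
  (A * B) i j = \big[add0 (S := S)/zero0 S]_(k < n) (A i k * B k j).
Proof. by rewrite [LHS]mxE (fold1_ord i). Qed.

Section UpperTriangular.
Variables (S : bareSemiringType) (n : nat).

Definition is_UT (A : Mn (adjoin0 S) n) : bool :=
  [forall i : 'I_n, forall j : 'I_n,
     if (j < i)%N then A i j == zero0 S
     else `[< exists s : S, A i j = inj0 s >]].

Lemma is_UTP (A : Mn (adjoin0 S) n) :
  reflect (forall i j : 'I_n, if (j < i)%N then A i j = zero0 S else in_S (A i j))
          (is_UT A).
Proof.
apply: (iffP idP) => [/forallP h i j|h].
  by have /forallP /(_ j) := h i; case: ifP => _; [move/eqP | move/asboolP].
apply/forallP => i; apply/forallP => j; have := h i j.
by case: ifP => _; [move/eqP | move/asboolP].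
Qed.

Definition UT : Type := {A : Mn (adjoin0 S) n | is_UT A}.
HB.instance Definition _ := SubChoice.on UT.

Lemma UT_mul_subproof (A B : UT) : is_UT (val A * val B).
Proof.
case: A B => [A /is_UTP hA] [B /is_UTP hB] /=; apply/is_UTP => i j.
rewrite Mn0_mulE; case: ifP => ltji.
  apply: big1 => k _; have := hA i k; case: ifP => [_ ->|leik _].
    exact: mul0z.
  have ltjk : (j < k)%N by apply: leq_trans ltji _; rewrite leqNgt leik.
  have := hB k j; rewrite ltjk => ->.
  exact: mulz0.
rewrite (bigD1 i) //=; apply: in_S_add.
  apply: in_S_mul; first by have := hA i i; rewrite ltnn.
  by have := hB i j; rewrite ltji.
apply: in_S0_sum => k; apply: in_S0_mul.
  by have := hA i k; case: ifP => _; [right | left].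
by have := hB k j; case: ifP => _; [right | left].
Qed.

Definition UT_mul (A B : UT) : UT := Sub (val A * val B) (UT_mul_subproof A B).

Lemma UT_mulA : associative UT_mul.
Proof. by move=> A B C; apply: val_inj; rewrite /= mulgA. Qed.

HB.instance Definition _ := isSemigroup.Build UT UT_mulA.

End UpperTriangular.

Section Unitriangular.
Variables (S : bareSemiringType) (n : nat).

Definition adjoin01 : semigroupType := adjoin1 (adjoin0 S).

Local Notation Z := (adjoin0 S).
Local Notation "'\sumz_' ( k < m ) F" := (\big[add0 (S := S)/zero0 S]_(k < m) F)
  (at level 41, F at level 41, k, m at level 50).

Definition is_Un (A : 'M[adjoin01]_n) : bool :=
  [forall i : 'I_n, forall j : 'I_n,
     if (j < i)%N then A i j == inj1 (zero0 S)
     else if i == j then A i j == one1 Z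
     else `[< exists s : S, A i j = inj1 (inj0 s) >]].

Definition Un : Type := {A : 'M[adjoin01]_n | is_Un A}.
HB.instance Definition _ := SubChoice.on Un.

Lemma is_UnP (A : 'M[adjoin01]_n) :
  reflect (exists2 a : 'I_n -> 'I_n -> Z,
             forall i j, A i j = if i == j then one1 Z else inj1 (a i j) &
             forall i j : 'I_n, if (i < j)%N then in_S (a i j) else a i j = zero0 S)
          (is_Un A).
Proof.
apply: (iffP idP) => [/forallP h|[a hA ha]]; last first.
  apply/forallP => i; apply/forallP => j; have := ha i j; rewrite hA.
  rewrite -val_eqE /=; case: ltngtP => // _.
    by move=> [s ->]; apply/asboolP; exists s.
  by move=> ->.
have {}h i j : exists y : Z,
    A i j = (if i == j then one1 Z else inj1 y) /\
    if (i < j)%N then in_S y else y = zero0 S.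
  have /forallP /(_ j) := h i; rewrite -val_eqE /=; case: ltngtP => _.
  - by move=> /eqP ->; exists (zero0 S).
  - by move=> /asboolP [s ->]; exists (inj0 s); split=> //; exists s.
  - by move=> /eqP ->; exists (zero0 S).
pose a i j := sval (cid (h i j)).
by exists a => i j; rewrite /a; case: cid => y [].
Qed.

Definition Un_entry (A B : 'M[adjoin01]_n) i j : option adjoin01 :=
  sum1 [seq A i k * B k j | k <- enum 'I_n].

Definition star (a b : 'I_n -> 'I_n -> Z) i j : Z :=
  add0 (add0 (a i j) (b i j)) (\sumz_(k < n) (mul0 (a i k) (b k j))).

Lemma sum1_inj (x0 : Z) (s : seq Z) : s != [::] ->
  sum1 [seq inj1 x | x <- s] = Some (inj1 (fold1 (@Algebra.add Z) x0 s)).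
Proof.
case: s => // x s _ /=.
by elim: s x => //= y s IHs x; rewrite add1_inj IHs.
Qed.

Lemma sum1_one (i : 'I_n) (s : seq 'I_n) : uniq s -> i \in s ->
  sum1 [seq if k == i then one1 Z else inj1 (zero0 S) | k <- s] =
  Some (one1 Z).
Proof.
pose F k := if k == i then one1 Z else inj1 (zero0 S).
pose G := foldl (fun o y => obind ((@add1 Z)^~ y) o).
have [z1 oz] := add1_01 (@zero0P S).
have Gs x y u : G (Some x) (y :: u) = G (add1 x y) u by [].
have Fi : F i = one1 Z by rewrite /F eqxx.
have Fk k : k != i -> F k = inj1 (zero0 S) by rewrite /F => /negPf ->.
have h1 t : i \notin t -> G (Some (one1 Z)) (map F t) = Some (one1 Z).
  elim: t => // k t IHt; rewrite inE negb_or eq_sym => /andP[ki it].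
  by rewrite map_cons Gs Fk // oz IHt.
have h0 t : uniq t -> i \in t ->
    G (Some (inj1 (zero0 S))) (map F t) = Some (one1 Z).
  elim: t => // k t IHt /andP[kt ut]; rewrite inE eq_sym map_cons Gs.
  have [ki _|ki /= it] := eqVneq k i.
    by rewrite ki Fi z1 h1 // -ki.
  by rewrite Fk // add1_inj; have [_ _ -> _] := zero0P (zero0 S); apply: IHt.
case: s => // k s /andP[ks us]; rewrite inE eq_sym => ik.
change (G (Some (F k)) (map F s) = Some (one1 Z)).
have [ki|ki] := eqVneq k i; first by rewrite ki Fi h1 // -ki.
by rewrite Fk //; apply: h0 => //; move: ik; rewrite (negPf ki).
Qed.

Lemma Un_entryE (A B : 'M[adjoin01]_n) a b :
  (forall i j, A i j = if i == j then one1 Z else inj1 (a i j)) ->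
  (forall i j : 'I_n, if (i < j)%N then in_S (a i j) else a i j = zero0 S) ->
  (forall i j, B i j = if i == j then one1 Z else inj1 (b i j)) ->
  (forall i j : 'I_n, if (i < j)%N then in_S (b i j) else b i j = zero0 S) ->
  forall i j,
    Un_entry A B i j = Some (if i == j then one1 Z else inj1 (star a b i j)).
Proof.
move=> hA ha hB hb i j; rewrite /Un_entry.
have a0 (k l : 'I_n) : (l <= k)%N -> a k l = zero0 S.
  by move=> h; have := ha k l; rewrite ltnNge h.
have b0 (k l : 'I_n) : (l <= k)%N -> b k l = zero0 S.
  by move=> h; have := hb k l; rewrite ltnNge h.
case: (altP (i =P j)) => [<-|nij].
  rewrite -(sum1_one (enum_uniq 'I_n) (mem_enum _ i)); congr sum1.
  apply: eq_map => k; rewrite hA hB eq_sym; case: eqP => _.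
    by case: (one1P (one1 Z)).
  rewrite -inj1M; congr inj1; case: (leqP k i) => h.
    by rewrite a0 //; apply: mul0z.
  by rewrite (b0 k i) ?(ltnW h) //; apply: mulz0.
pose c k := if k == i then b i j else zero0 S.
pose d k := if k == j then a i j else zero0 S.
pose g k := add0 (add0 (d k) (c k)) (mul0 (a i k) (b k j)).
have -> : [seq A i k * B k j | k <- enum 'I_n] =
          [seq inj1 x | x <- [seq g k | k <- enum 'I_n]].
  rewrite -[RHS]map_comp; apply: eq_map => k /=; rewrite hA hB /g /c /d eq_sym.
  have [->|nki] := eqVneq k i; rewrite ?(negPf nij) /=.
    by rewrite a0 // mul0z add0z Monoid.mulm1; case: (one1P (inj1 (b i j))).
  have [->|nkj] := eqVneq k j.
    by rewrite b0 // mulz0 !Monoid.mulm1; case: (one1P (inj1 (a i j))).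
  by rewrite !add0z inj1M.
rewrite (sum1_inj (zero0 S)); last first.
  rewrite -size_eq0 size_map size_enum_ord.
  by rewrite -lt0n; apply: leq_ltn_trans (ltn_ord i).
congr (Some (inj1 _)); rewrite (fold1_ord i) /g !big_split /=; congr add0.
by congr add0; rewrite -big_mkcond /= big_pred1_eq.
Qed.

Lemma star_in_S a b :
  (forall i j : 'I_n, if (i < j)%N then in_S (a i j) else a i j = zero0 S) ->
  (forall i j : 'I_n, if (i < j)%N then in_S (b i j) else b i j = zero0 S) ->
  forall i j : 'I_n,
    if (i < j)%N then in_S (star a b i j) else star a b i j = zero0 S.
Proof.
move=> ha hb i j; rewrite /star; case: ifP => ltij.
  have := ha i j; have := hb i j; rewrite ltij => hbij haij.
  apply: in_S_add; first by apply: in_S_add => //; left.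
  apply: in_S0_sum => k; apply: in_S0_mul.
    by have := ha i k; case: ifP => _; [left | right].
  by have := hb k j; case: ifP => _; [left | right].
have := ha i j; have := hb i j; rewrite ltij => -> ->.
rewrite add0z big1 ?add0z // => k _.
have := ha i k; case: ifP => [ik _|_ ->]; last exact: mul0z.
have := hb k j; case: ifP => [kj _|_ ->]; last exact: mulz0.
by rewrite (ltn_trans ik kj) in ltij.
Qed.

(* All the sums needed to multiply two matrices of U_n(S) are defined. *)
Lemma Un_entry_defined (A B : Un) i j :
  exists x, Un_entry (val A) (val B) i j = Some x.
Proof.
case: A B => [A /is_UnP[a hA ha]] [B /is_UnP[b hB hb]] /=.
by rewrite (Un_entryE hA ha hB hb); eexists.
Qed.

(* By [Un_entry_defined] the default value [A i j] is never used. *)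
Definition Un_mulmx (A B : 'M[adjoin01]_n) : 'M[adjoin01]_n :=
  \matrix_(i, j) odflt (A i j) (Un_entry A B i j).

Lemma Un_mul_subproof (A B : Un) : is_Un (Un_mulmx (val A) (val B)).
Proof.
case: A B => [A /is_UnP[a hA ha]] [B /is_UnP[b hB hb]] /=.
apply/is_UnP; exists (star a b); last exact: star_in_S.
by move=> i j; rewrite mxE (Un_entryE hA ha hB hb).
Qed.

Definition Un_mul (A B : Un) : Un :=
  Sub (Un_mulmx (val A) (val B)) (Un_mul_subproof A B).

(* [star] is a + b + a b, the operation induced on strictly upper triangular
   parts. *)
Lemma starA a b c i j : star a (star b c) i j = star (star a b) c i j.
Proof.
rewrite /star.
have -> : \sumz_(k < n) (mul0 (a i k) (add0 (add0 (b k j) (c k j))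
                 (\sumz_(l < n) mul0 (b k l) (c l j)))) =
          add0 (add0 (\sumz_(k < n) (mul0 (a i k) (b k j)))
                     (\sumz_(k < n) (mul0 (a i k) (c k j))))
               (\sumz_(k < n) (\big[add0 (S := S)/zero0 S]_(l < n)
                         mul0 (mul0 (a i l) (b l k)) (c k j))).
  under eq_bigr do rewrite !mul0Dr big_distrr /=.
  rewrite !big_split /=; congr add0; rewrite exchange_big /=.
  by do 2!apply: eq_bigr => ? _; apply: mulgA.
have -> : \sumz_(k < n) (mul0 (add0 (add0 (a i k) (b i k))
                 (\big[add0 (S := S)/zero0 S]_(l < n) mul0 (a i l) (b l k)))
                 (c k j)) =
          add0 (add0 (\sumz_(k < n) (mul0 (a i k) (c k j)))
                     (\sumz_(k < n) (mul0 (b i k) (c k j))))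
               (\sumz_(k < n) (\big[add0 (S := S)/zero0 S]_(l < n)
                         mul0 (mul0 (a i l) (b l k)) (c k j))).
  under eq_bigr do rewrite !mul0Dl big_distrl /=.
  by rewrite !big_split.
by rewrite (@add0 S).[AC ((1*3)*3) ((((1*2)*5)*3)*((6*4)*7))].
Qed.

Lemma Un_mulA : associative Un_mul.
Proof.
move=> A B C; apply: val_inj => /=.
case: A B C => [A /is_UnP[a hA ha]] [B /is_UnP[b hB hb]] [C /is_UnP[c hC hc]] /=.
have hAB i j : Un_mulmx A B i j = if i == j then one1 Z else inj1 (star a b i j).
  by rewrite mxE (Un_entryE hA ha hB hb).
have hBC i j : Un_mulmx B C i j = if i == j then one1 Z else inj1 (star b c i j).
  by rewrite mxE (Un_entryE hB hb hC hc).
apply/matrixP => i j; rewrite [LHS]mxE [RHS]mxE.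
rewrite (Un_entryE hA ha hBC (star_in_S hb hc)).
by rewrite (Un_entryE hAB (star_in_S ha hb) hC hc) starA.
Qed.

HB.instance Definition _ := isSemigroup.Build Un Un_mulA.

End Unitriangular.

(* Main.v *)
Require Import Defs.
From HB Require Import structures.
From mathcomp Require Import all_boot all_fingroup.
From mathcomp Require Import ssralg matrix.
From mathcomp Require Import classical_sets cardinality.
From mathcomp Require Import zify.

(**
Bipotence and distributivity turn the positive powers of a single element x
into a monotone chain.  If x + x^2 = x^2 then x^i + x^j = x^(max i j), and if
x + x^2 = x then x^i + x^j = x^(min i j).  In the first case put
g M e = x^(M + e), in the second g M e = x^(M - e), for e < M.  Both cases then
look alike: on each grade M the addition is the maximum of the e, the product
adds the grades and the e, and g M is injective once x has a large enough
multiplicative order for M ([maxplus_scale_exists]).  Hence it is enough to exhibit,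
for every k, matrices s_0, ..., s_(k-1) with natural number entries such that
one entry of their max-plus products taken in the order l is minimal only for
l = 0, ..., k-1 ([not_strongly_permutable]); the grade then only has to
exceed the entries.  There is one such family for each semigroup.

- In M_n, every s_j is an outer product in_wt j r + out_wt j c, so the
  entry (0, 0) of a product is the sum of a term for each end and of one link
  cost for each pair of consecutive factors.  Putting j right after i costs
  k + |j - i - 1|, which is least only for j = i + 1 ([link_weight_min]), and
  the term j that a first factor s_j contributes forces j = 0.  Only
  two values of an index matter, so all indices but 0 are given the same
  weight: this settles all n >= 2.

- In UT_n, the entry (0, 1) is that of the 2 x 2 case, a scheduling problem:
  unit jobs are run one after the other from time 0, and the result of job j
  is ready k - 1 - j after its start.  All results are ready by time k - 1
  exactly when no job starts later than its own number, which leaves one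
  permutation ([delay_le], [perm_iota_geq]).

- In U_n, the entry in row 0 and column 2 is the maximum of i + (k - j) over
  the pairs i, j with i before j, and it is at most k - 1 exactly when the
  order is increasing ([inversion_wt_le]).

For n <= 2 no path has two steps above the diagonal, so U_n is commutative,
and exchanging two factors is the required permutation.
*)

Set Implicit Arguments.
Unset Strict Implicit.
Unset Printing Implicit Defensive.

Local Open Scope ring_scope.
Local Open Scope group_scope.

(** * Powers of one element *)

Section PositivePowers.
Variable T : semigroupType.
Implicit Types (x : T) (m n : nat).

Definition pospow x n : T := iterop n (@monoid.mul T) x x.

Lemma pospowS x n : (0 < n)%N -> pospow x n.+1 = x * pospow x n.
Proof. by case: n. Qed.

Lemma pospowD x m n : (0 < m)%N -> (0 < n)%N ->
  pospow x (m + n) = pospow x m * pospow x n.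
Proof.
case: m => // m _ n_gt0; elim: m => [|m IHm]; first by rewrite add1n pospowS.
by rewrite addSn pospowS // IHm [in RHS]pospowS // mulgA.
Qed.

(** A coincidence x^m = x^n with m < n makes the powers periodic from m on, so
every power is one of x, ..., x^(n-1), too few for the order of x. *)
Lemma pospow_lt_inj x K m n : mul_order_gt x K ->
  (0 < m)%N -> (m < n)%N -> (n <= K.+1)%N -> pospow x m <> pospow x n.
Proof.
move=> xK m_gt0 lt_mn le_nK eq_mn; apply: xK.
have red d : (0 < d)%N ->
    exists2 e, (0 < e <= K)%N & pospow x d = pospow x e.
  (* Subtracting the period n - m brings any exponent down to at most K. *)
  elim/ltn_ind: d => d IHd d_gt0.
  have [lt_dn|le_nd] := ltnP d n; first by exists d => //; lia.
  have -> : pospow x d = pospow x (d - (n - m)).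
    have [->|ne_dn] := eqVneq d n; first by rewrite -eq_mn subKn // ltnW.
    have {1}-> : d = (n + (d - n))%N by lia.
    have -> : (d - (n - m) = m + (d - n))%N by lia.
    by rewrite !pospowD; first (by rewrite eq_mn); lia.
  by apply: IHd; lia.
apply: (@card_le_trans _ _ _ [set pospow x i.+1 | i in `I_K]%classic).
  apply: subset_card_le => y [d _ <-].
  have [[|e] // le_eK e_pow] := red d.+1 isT.
  by exists e => //; rewrite -e_pow.
exact: card_image_le.
Qed.

End PositivePowers.

(** * A graded max-plus semiring inside a bipotent semiring *)

Section MaxPlusScale.
Variable S : bareSemiringType.

(** The element [g M e] stands for the number e on grade M.  The bound e < M
keeps the exponent M - e positive, and N bounds the grades because S may have
no element of infinite order. *)
Record maxplus_scale (N : nat) (g : nat -> nat -> S) : Prop := MaxPlusScale {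
  scaleM : forall M M' e e', (e < M)%N -> (e' < M')%N ->
    g M e * g M' e' = g (M + M')%N (e + e')%N;
  scaleD : forall M e e', (e < M)%N -> (e' < M)%N ->
    (g M e + g M e')%R = g M (maxn e e');
  scale_inj : forall M e e', (M <= N)%N -> (e < M)%N -> (e' < M)%N ->
    g M e = g M e' -> e = e'
}.

(** Multiplying x + x^2 = x^2 by x^(j-1) compares consecutive powers, and
associativity of the addition passes to distant ones. *)
Lemma pospow_add_up (x : S) i d : (x + x)%R = x -> (x + (x * x)%g)%R = x * x ->
  (0 < i)%N -> (pospow x i + pospow x (i + d))%R = pospow x (i + d).
Proof.
move=> xx up; have add_next j : (0 < j)%N ->
    (pospow x j + pospow x j.+1)%R = pospow x j.+1.
  case: j => [//|[//|j]] _.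
  have -> : pospow x j.+3 = x * x * pospow x j.+1 by rewrite 2?pospowS // mulgA.
  by rewrite {1}pospowS // -smulDl up.
move=> i_gt0; elim: d => [|d IHd]; last first.
  by rewrite addnS -(add_next (i + d)%N) ?Algebra.addrA ?IHd //; lia.
rewrite addn0; case: i i_gt0 => [//|[//|i]] _.
by rewrite pospowS // -smulDl xx.
Qed.

Lemma pospow_add_down (x : S) i d : (x + x)%R = x -> (x + (x * x)%g)%R = x ->
  (0 < i)%N -> (pospow x i + pospow x (i + d))%R = pospow x i.
Proof.
move=> xx down; have add_next j : (0 < j)%N ->
    (pospow x j + pospow x j.+1)%R = pospow x j.
  case: j => [//|[//|j]] _.
  have -> : pospow x j.+3 = x * x * pospow x j.+1 by rewrite 2?pospowS // mulgA.
  by rewrite pospowS // -smulDl down.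
move=> i_gt0; elim: d => [|d IHd]; last first.
  by rewrite addnS -[in LHS]IHd -Algebra.addrA add_next ?IHd //; lia.
rewrite addn0; case: i i_gt0 => [//|[//|i]] _.
by rewrite pospowS // -smulDl xx.
Qed.

(** On grades up to N the exponents M + e and M - e stay below 2N, so an
element of order greater than 2N + 1 has all the needed powers distinct. *)
Lemma maxplus_scale_exists (N : nat) : bipotent S -> unbounded_mul_order S ->
  exists g, maxplus_scale N g.
Proof.
move=> bipS /(_ N.*2.+1 isT)[x xN].
have inj i j : (0 < i)%N -> (0 < j)%N -> (i <= N.*2)%N -> (j <= N.*2)%N ->
    pospow x i = pospow x j -> i = j.
  move=> i_gt0 j_gt0 iN jN eq_ij; case: (ltngtP i j) => // lt_ij.
    by case: (pospow_lt_inj xN i_gt0 lt_ij _ eq_ij); lia.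
  by case: (pospow_lt_inj xN j_gt0 lt_ij _ (esym eq_ij)); lia.
have xx : (x + x)%R = x by case: (bipS x x).
case: (bipS x (x * x)) => [down|up].
  exists (fun M e => pospow x (M - e)); split.
  - by move=> M M' e e' ? ?; rewrite -pospowD; first (congr pospow); lia.
  - move=> M e e' eM eM'; wlog le_ee' : e e' eM eM' / (e' <= e)%N => [th|].
      by case/orP: (leq_total e' e) => h;
        [apply: th | rewrite (@Algebra.addrC S) maxnC; apply: th].
    have -> : (M - e' = M - e + (e - e'))%N by lia.
    by rewrite pospow_add_down //; [congr pospow|]; lia.
  - by move=> M e e' ? ? ? /inj; lia.
exists (fun M e => pospow x (M + e)); split.
- by move=> M M' e e' ? ?; rewrite -pospowD; first (congr pospow); lia.
- move=> M e e' eM eM'; wlog le_ee' : e e' eM eM' / (e <= e')%N => [th|].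
    by case/orP: (leq_total e e') => h;
      [apply: th | rewrite (@Algebra.addrC S) maxnC; apply: th].
  have -> : (M + e' = M + e + (e' - e))%N by lia.
  by rewrite pospow_add_up //; [congr pospow|]; lia.
- by move=> M e e' ? ? ? /inj; lia.
Qed.

End MaxPlusScale.

(** * Reordered products *)

Section OrderedProducts.
Variable T : semigroupType.

(** For nonempty [l]; the value at the empty sequence is junk. *)
Definition seq_prod (s : nat -> T) (l : seq nat) : T :=
  foldl (@monoid.mul T) (s (head 0 l)) (map s (behead l)).

(** Indexing the factors by natural numbers allows products to be computed by
induction on the list of the indices. *)
Lemma not_strongly_permutable (V : Type) (f : T -> V) :
  (forall k, exists s : nat -> T, forall l, perm_eq l (iota 0 k.+2) ->
     f (seq_prod s l) = f (seq_prod s (iota 0 k.+2)) -> l = iota 0 k.+2) ->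
  ~ strongly_permutable T.
Proof.
move=> hf [k spk]; have [s hs] := hf k.
have [sigma nt_sigma eq_prod] := spk (fun i => s i).
have prodE (t : 'I_k.+2 -> 'I_k.+2) :
    ord_prod (fun i => s (t i)) = seq_prod s [seq val (t i) | i <- enum 'I_k.+2].
  rewrite /ord_prod /seq_prod; case: (enum 'I_k.+2) (size_enum_ord k.+2) => //= i l _.
  by rewrite -map_comp.
have enumE : [seq val (sigma i) | i <- enum 'I_k.+2] = iota 0 k.+2.
  apply: hs; last by rewrite -prodE -val_enum_ord -(prodE id); congr f.
  rewrite -val_enum_ord (map_comp val sigma); apply: perm_map.
  apply: uniq_perm; rewrite ?(map_inj_uniq perm_inj) ?enum_uniq //.
  by move=> i; rewrite mem_enum -[i](permKV sigma) (mem_map perm_inj) mem_enum.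
case/eqP: nt_sigma; apply/permP => i; apply: val_inj; rewrite perm1.
have := congr1 (nth 0 ^~ i) enumE.
by rewrite (nth_map ord0) ?size_enum_ord // nth_ord_enum nth_iota.
Qed.

End OrderedProducts.

Lemma perm_iota_lt k (l : seq nat) : perm_eq l (iota 0 k) -> all (gtn k) l.
Proof. by move/perm_all->; apply/allP => i; rewrite mem_iota. Qed.

Section OnScale.
Variables (S : bareSemiringType) (N : nat) (g : nat -> nat -> S).
Hypothesis gP : maxplus_scale N g.
Implicit Types (M e : nat) (z : S).

(** The bound is part of the statement so that it is carried along through
products and sums. *)
Definition on_scale M e z := (e < M)%N /\ z = g M e.

Lemma on_scaleM M M' e e' z z' :
  on_scale M e z -> on_scale M' e' z' -> on_scale (M + M') (e + e') (z * z').
Proof. by move=> [eM ->] [eM' ->]; split; [lia | rewrite (scaleM gP)]. Qed.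

Lemma on_scaleD M e e' z z' :
  on_scale M e z -> on_scale M e' z' -> on_scale M (maxn e e') (z + z')%R.
Proof. by move=> [eM ->] [eM' ->]; split; [lia | rewrite (scaleD gP)]. Qed.

Lemma on_scale_inj M e e' z : (M <= N)%N ->
  on_scale M e z -> on_scale M e' z -> e = e'.
Proof. by move=> MN [eM ->] [eM' /(scale_inj gP MN)]; apply. Qed.

Lemma on_scale_sum n M (e : 'I_n.+1 -> nat) (z : 'I_n.+1 -> S) z0 :
  (forall i, on_scale M (e i) (z i)) ->
  on_scale M (\max_i e i)
    (fold1 (@Algebra.add S) z0 [seq z i | i <- enum 'I_n.+1]).
Proof.
move=> ez; rewrite -big_enum /=.
case: (enum 'I_n.+1) (size_enum_ord n.+1) => //= i s _; rewrite big_cons.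
elim: s (e i) (z i) (ez i) => [|j s IHs] d x dx /=; first by rewrite big_nil maxn0.
by rewrite big_cons maxnA; apply/IHs/on_scaleD.
Qed.

End OnScale.

Lemma maxplus_scale_inj0 (S : bareSemiringType) N (g : nat -> nat -> S) :
  maxplus_scale N g -> maxplus_scale N (fun M e => inj0 (g M e)).
Proof.
case=> gM gD g_inj; split.
- by move=> M M' e e' eM eM'; rewrite -inj0M gM.
- by move=> M e e' eM eM'; rewrite -inj0D gD.
- by move=> M e e' MN eM eM' /inj0_inj; apply: g_inj.
Qed.

(** * Full matrices *)

Section FullMatrices.
Variable k : nat.
Implicit Types (i j w : nat) (l : seq nat).

(** This is k + |j - i - 1| for i, j < k: one argument of the maximum is
k + (j - i - 1) and the other k - (j - i - 1). *)
Definition link i j := maxn (k.-1 - i + j) (i.+1 + (k - j)).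

(** The final term k - 1 - i is the contribution [out_wt i ord0] of the last
factor to the corner entry. *)
Fixpoint link_weight w i l :=
  if l is j :: l' then link_weight (w + link i j) j l' else (w + (k.-1 - i))%N.

Lemma link_weight_ge w i l : (i < k)%N -> all (gtn k) l ->
  (w + k * size l <= link_weight w i l)%N.
Proof.
elim: l w i => [|j l IHl] w i ik /=; first by rewrite muln0; lia.
case/andP=> jk lk; apply: leq_trans (IHl _ _ jk lk).
by rewrite mulnS /link; lia.
Qed.

(** Each link costs at least k, so a total of k per link forces every index
to be the successor of the previous one. *)
Lemma link_weight_min w i l : (i < k)%N -> all (gtn k) l ->
  (link_weight w i l <= w + k * size l)%N -> l = iota i.+1 (size l).
Proof.
elim: l w i => [|j l IHl] w i ik //= /andP[jk lk] le_w.
have ge_w := link_weight_ge (w + link i j) jk lk.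
have ji : j = i.+1 by move: le_w ge_w; rewrite mulnS /link; lia.
congr (_ :: _) => //; rewrite -ji; apply: IHl jk lk _.
by apply: leq_trans le_w _; rewrite mulnS /link; lia.
Qed.

Lemma link_weight_iota w i m : (i + m = k.-1)%N ->
  link_weight w i (iota i.+1 m) = (w + k * m)%N.
Proof.
elim: m w i => [|m IHm] w i im /=; first by lia.
by rewrite IHm ?mulnS /link; lia.
Qed.

Variables (S : bareSemiringType) (N : nat) (g : nat -> nat -> S) (n C : nat).
Hypotheses (gP : maxplus_scale N g) (kC : (k.*2 < C)%N).

Definition out_wt i (c : 'I_n.+2) := if c == ord0 then (k.-1 - i)%N else i.+1.
Definition in_wt j (r : 'I_n.+2) := if r == ord0 then j else (k - j)%N.
Definition link_mx j : Mn S n.+2 := \matrix_(r, c) g C (in_wt j r + out_wt j c)%N.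

Lemma link_mx_scale j r c : (j < k)%N ->
  on_scale g C (in_wt j r + out_wt j c) (link_mx j r c).
Proof.
move=> jk; rewrite mxE; split=> //.
by rewrite /in_wt /out_wt; do 2 case: eqP; lia.
Qed.

Lemma max_link w i j a :
  \max_(t < n.+2) (w + out_wt i t + (in_wt j t + a)) = (w + link i j + a)%N.
Proof.
apply/eqP; rewrite eqn_leq; apply/andP; split.
  by apply/bigmax_leqP => t _; rewrite /out_wt /in_wt /link; case: eqP; lia.
pose F (t : 'I_n.+2) := (w + out_wt i t + (in_wt j t + a))%N.
have := leq_bigmax (F := F) ord_max; have := leq_bigmax (F := F) ord0.
by rewrite /F /out_wt /in_wt /link /=; lia.
Qed.

(** As the factors are outer products, the row 0 of a partial product depends
only on a constant w and on the last factor i, and this is preserved by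
multiplication. *)
Lemma link_mx_prod l M w i (P : Mn S n.+2) : all (gtn k) l ->
  (forall c, on_scale g M (w + out_wt i c) (P ord0 c)) ->
  on_scale g (M + size l * C) (link_weight w i l)
    (foldl (@monoid.mul (Mn S n.+2)) P (map link_mx l) ord0 ord0).
Proof.
elim: l M w i P => [|j l IHl] M w i P /=; first by rewrite mul0n addn0 => _ /(_ ord0).
case/andP=> jk lk Pi; rewrite mulSn addnA; apply: IHl => // c.
rewrite mxE -max_link; apply: (on_scale_sum gP) => t.
by apply: (on_scaleM gP); [apply: Pi | apply: link_mx_scale].
Qed.

End FullMatrices.

Lemma Mn_not_strongly_permutable (S : bareSemiringType) n :
  bipotent S -> unbounded_mul_order S ->
  ~ strongly_permutable (Mn S n.+2).
Proof.
move=> bipS ordS.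
apply: (@not_strongly_permutable _ _ (fun A : Mn S n.+2 => A ord0 ord0)) => k0.
set k := k0.+2; pose C := k.*2.+1.
have [g gP] := maxplus_scale_exists (k * C) bipS ordS.
pose s : nat -> Mn S n.+2 := @link_mx k S g n C.
have prodP i l : all (gtn k) (i :: l) ->
    on_scale g (C + size l * C) (link_weight k i i l) (seq_prod s (i :: l) ord0 ord0).
  case/andP=> ik lk; apply: (link_mx_prod gP (ltnSn _)) => // c.
  exact: (link_mx_scale g (ltnSn k.*2) ord0 c ik).
exists s => l l_iota eq_prod.
have := perm_size l_iota; have := perm_iota_lt l_iota.
case: l {l_iota} eq_prod => // i l eq_prod lk; rewrite size_iota => -[size_l].
have iotak := perm_iota_lt (perm_refl (iota 0 k)).
have := prodP _ _ lk; rewrite eq_prod size_l => il.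
have := prodP 0 (iota 1 k0.+1) iotak; rewrite size_iota => /(on_scale_inj gP _ il).
rewrite -mulSn leqnn => /(_ isT); rewrite link_weight_iota // => wt_il.
case/andP: lk => ik lk.
have i0 : i = 0 by have := link_weight_ge i ik lk; rewrite wt_il size_l; lia.
have wt_le : (link_weight k i i l <= i + k * size l)%N by rewrite wt_il size_l i0.
by rewrite (link_weight_min ik lk wt_le) i0 size_l.
Qed.

(** * Upper triangular matrices *)

Section TriangularMatrices.
Variable k : nat.
Implicit Types (i j m w : nat) (l : seq nat).

(** The time when all results are ready, if the unit jobs [l] are run from time
m on, the result of job j takes k - 1 - j from its start, and the earlier jobs
have their results at time w. *)
Fixpoint delay m w l :=
  if l is j :: l' then delay m.+1 (maxn (m + (k.-1 - j)) w) l' else w.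

Lemma delay_le m w l : all (gtn k) l ->
  (delay m w l <= k.-1)%N = (w <= k.-1)%N && all2 leq (iota m (size l)) l.
Proof.
elim: l m w => [|j l IHl] m w /=; first by rewrite andbT.
case/andP=> jk lk; rewrite IHl // geq_max andbA; congr (_ && _).
by rewrite andbC; congr (_ && _); lia.
Qed.

Lemma all2_leq_refl (s : seq nat) : all2 leq s s.
Proof. by elim: s => //= i s ->; rewrite leqnn. Qed.

(** The value m can only stand in the first position, since later positions
require larger values; then one proceeds by induction. *)
Lemma perm_iota_geq m l : perm_eq l (iota m (size l)) ->
  all2 leq (iota m (size l)) l -> l = iota m (size l).
Proof.
elim: l m => //= i l IHl m perm_l /andP[le_mi le_l].
have i_m : i = m.
  have : m \in i :: l by rewrite (perm_mem perm_l) mem_head.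
  rewrite inE => /predU1P[->//|ml].
  suff /(allP) /(_ m ml) : all (leq m.+1) l by rewrite ltnn.
  move: le_l; elim: (l) m.+1 => //= j l' IHl' p /andP[-> /IHl'].
  by apply: sub_all => q /ltnW.
by congr (_ :: _) => //; apply: IHl le_l; move: perm_l; rewrite i_m perm_cons.
Qed.

Variables (S : bareSemiringType) (N : nat) (g : nat -> nat -> S) (n C : nat).
Hypotheses (gP : maxplus_scale N g) (kC : (k < C)%N).

Let zero_ord : 'I_n.+2 := ord0.
Let one_ord : 'I_n.+2 := Ordinal (isT : 1 < n.+2).

Lemma UT_mul00 (A B : UT S n.+2) : val (A * B) zero_ord zero_ord =
  val A zero_ord zero_ord * val B zero_ord zero_ord.
Proof.
rewrite [LHS]Mn0_mulE big_ord_recl big1 ?Monoid.mulm1 // => t _.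
have /is_UTP/(_ (lift ord0 t) ord0) /= -> := valP B.
exact: mulz0.
Qed.

Lemma UT_mul01 (A B : UT S n.+2) : val (A * B) zero_ord one_ord =
  add0 (val A zero_ord zero_ord * val B zero_ord one_ord)
       (val A zero_ord one_ord * val B one_ord one_ord).
Proof.
rewrite [LHS]Mn0_mulE 2!big_ord_recl big1 ?Monoid.mulm1 => [|t _].
  by congr add0; congr (val A _ _ * val B _ _); apply: val_inj.
have /is_UTP/(_ (lift ord0 (lift ord0 t)) one_ord) /= -> := valP B.
exact: mulz0.
Qed.

(** On the block of the first two indices, the diagonal entries 1 and 0 make
the entry (0, 0) of a product count the jobs done so far, while the entry
(0, 1) records when all their results are ready. *)
Definition task_wt j (r c : 'I_n.+2) :=
  if r != ord0 then 0%N else if c == ord0 then 1%N else (k.-1 - j)%N.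

Lemma task_mx_subproof j : is_UT (S := S) (n := n.+2) (\matrix_(r, c)
  if (c < r)%N then zero0 S else inj0 (g C (task_wt j r c))).
Proof. by apply/is_UTP => r c; rewrite mxE; case: (c < r)%N => //; eexists. Qed.

Definition task_mx j : UT S n.+2 := Sub _ (task_mx_subproof j).

Lemma task_mx_scale j (r c : 'I_n.+2) : (r <= c)%N -> (0 < k)%N ->
  on_scale (fun M e => inj0 (g M e)) C (task_wt j r c) (val (task_mx j) r c).
Proof.
rewrite leqNgt => rc k0; rewrite mxE (negPf rc); split=> //.
by rewrite /task_wt; case: (r == _); case: (c == _) => /=; lia.
Qed.

Lemma task_mx_prod l M m w (P : UT S n.+2) : all (gtn k) l ->
  on_scale (fun M e => inj0 (g M e)) M m (val P zero_ord zero_ord) ->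
  on_scale (fun M e => inj0 (g M e)) M w (val P zero_ord one_ord) ->
  on_scale (fun M e => inj0 (g M e)) (M + size l * C) (delay m w l)
    (val (foldl (@monoid.mul (UT S n.+2)) P (map task_mx l)) zero_ord one_ord).
Proof.
have gP0 := maxplus_scale_inj0 gP.
elim: l M m w P => [|j l IHl] M m w P /=; first by rewrite mul0n addn0.
case/andP=> jk lk P00 P01; rewrite mulSn addnA.
have k_gt0 : (0 < k)%N by apply: leq_trans jk.
apply: IHl => //.
  rewrite UT_mul00 -addn1; apply: (on_scaleM gP0) => //.
  exact: (task_mx_scale j (leqnn zero_ord) k_gt0).
rewrite UT_mul01; apply: (on_scaleD gP0).
  apply: (on_scaleM gP0) => //.
  exact: (task_mx_scale j (isT : zero_ord <= one_ord)%N k_gt0).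
rewrite -[w]addn0; apply: (on_scaleM gP0) => //.
exact: (task_mx_scale j (leqnn one_ord) k_gt0).
Qed.

End TriangularMatrices.

Lemma UT_not_strongly_permutable (S : bareSemiringType) n :
  bipotent S -> unbounded_mul_order S ->
  ~ strongly_permutable (UT S n.+2).
Proof.
move=> bipS ordS.
pose one_ord : 'I_n.+2 := Ordinal (isT : 1 < n.+2).
apply: (@not_strongly_permutable _ _ (fun A : UT S n.+2 => val A ord0 one_ord)) => k0.
set k := k0.+2; pose C := k.+1.
have [g gP] := maxplus_scale_exists (k * C) bipS ordS.
pose s : nat -> UT S n.+2 := @task_mx k S g n C.
have prodP i l : all (gtn k) (i :: l) ->
    on_scale (fun M e => inj0 (g M e)) (C + size l * C) (delay k 1 (k.-1 - i) l)
      (val (seq_prod s (i :: l)) ord0 one_ord).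
  case/andP=> ik lk; apply: (task_mx_prod gP (ltnSn _)) => //.
    exact: (task_mx_scale g (ltnSn k) i (leqnn (ord0 : 'I_n.+2))).
  exact: (task_mx_scale g (ltnSn k) i (leq0n one_ord : (ord0 : 'I_n.+2) <= one_ord)%N).
exists s => l l_iota eq_prod.
have size_l : size l = k by rewrite (perm_size l_iota) size_iota.
rewrite -size_l; apply: perm_iota_geq; first by rewrite size_l.
have lk := perm_iota_lt l_iota.
case: l {l_iota} size_l eq_prod lk => // i l [size_l] eq_prod lk.
have iotak := perm_iota_lt (perm_refl (iota 0 k)).
have := prodP _ _ lk; rewrite eq_prod size_l => il.
have := prodP 0 (iota 1 k0.+1) iotak; rewrite size_iota.
move=> /(on_scale_inj (maxplus_scale_inj0 gP) _ il).
rewrite -mulSn leqnn => /(_ isT) wt_il.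
have : (delay k 1 (k.-1 - i) l <= k.-1)%N.
  by rewrite wt_il delay_le ?size_iota ?all2_leq_refl ?subn0 ?leqnn.
by case/andP: lk => ik lk; rewrite delay_le //= => /andP[].
Qed.

(** * Unitriangular matrices *)

Section UnitriangularMatrices.
Variable k : nat.
Implicit Types (i j a w : nat) (l : seq nat).

(** The state a is the greatest index met so far, so that w becomes the
maximum of its initial value and the i + (k - j) over the pairs with i
before j. *)
Fixpoint inversion_wt a w l :=
  if l is j :: l' then inversion_wt (maxn a j) (maxn w (a + (k - j))) l' else w.

(** A step is cheap enough, a + (k - j) <= k - 1, exactly when a < j: then j is
the new maximum. *)
Lemma inversion_wt_le a w l : all (gtn k) l ->
  (inversion_wt a w l <= k.-1)%N = (w <= k.-1)%N && path ltn a l.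
Proof.
elim: l a w => [|j l IHl] a w /=; first by rewrite andbT.
case/andP=> jk lk; rewrite IHl // geq_max -andbA; congr (_ && _).
have -> : (a + (k - j) <= k.-1)%N = (a < j)%N by lia.
by case: ltnP => //= /ltnW/maxn_idPr ->.
Qed.

Variables (S : bareSemiringType) (N : nat) (g : nat -> nat -> S) (n C : nat).
Hypotheses (gP : maxplus_scale N g) (kC : (k < C)%N).

Let o0 : 'I_n.+3 := ord0.
Let o1 : 'I_n.+3 := Ordinal (isT : 1 < n.+3).
Let o2 : 'I_n.+3 := Ordinal (isT : 2 < n.+3).

Let injZ : adjoin0 S -> adjoin01 S := @inj1 (adjoin0 S).

(** The only path of two steps above the diagonal from 0 to 2 goes through 1,
and there is none from 0 to 1. *)
Lemma Un_mul_entries (A B : Un S n.+3) a01 a02 b01 b12 b02 :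
  val A o0 o1 = injZ a01 -> val A o0 o2 = injZ a02 ->
  val B o0 o1 = injZ b01 -> val B o1 o2 = injZ b12 -> val B o0 o2 = injZ b02 ->
  val (A * B) o0 o1 = injZ (add0 a01 b01) /\
  val (A * B) o0 o2 = injZ (add0 (add0 a02 b02) (a01 * b12)).
Proof.
case: A B => [A UA] [B UB] /=.
have /is_UnP[a hA ha] := UA; have /is_UnP[b hB hb] := UB.
rewrite !mxE !(Un_entryE hA ha hB hb) !hA !hB /=.
do 5![move/inj1_inj=> <-]; split; congr inj1; rewrite /star /=.
  rewrite big_ord_recl big1 ?Monoid.mulm1 => [|t _].
    by have := ha o0 o0 => /= ->; rewrite mul0z Monoid.mulm1.
  by have := hb (lift ord0 t) o1 => /= ->; apply: mulz0.
congr add0; rewrite 2!big_ord_recl big1 ?Monoid.mulm1 => [|t _].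
  have := ha o0 o0 => /= ->; rewrite mul0z add0z.
  by congr (a _ _ * b _ _); apply: val_inj.
by have := hb (lift ord0 (lift ord0 t)) o2 => /= ->; apply: mulz0.
Qed.

(** The entry (0, 2) is the least value on the grade C + C, on which the
product of the entries (0, 1) and (1, 2) falls. *)
Definition pair_entry j (r c : 'I_n.+3) : S :=
  if c == o1 then g C j else if r == o1 then g C (k - j) else g (C + C) 0.

Lemma pair_mx_subproof j : is_Un (\matrix_(r < n.+3, c < n.+3)
  if r == c then one1 (adjoin0 S)
  else injZ (if (r < c)%N then inj0 (pair_entry j r c) else zero0 S)).
Proof.
apply/is_UnP.
exists (fun r c : 'I_n.+3 => if (r < c)%N then inj0 (pair_entry j r c) else zero0 S).
  by move=> r c; rewrite mxE.
by move=> r c; case: (r < c)%N => //; eexists.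
Qed.

Definition pair_mx j : Un S n.+3 := Sub _ (pair_mx_subproof j).

Lemma pair_mx_prod l a w z1 z2 (P : Un S n.+3) : all (gtn k) l ->
  val P o0 o1 = injZ z1 -> on_scale (fun M e => inj0 (g M e)) C a z1 ->
  val P o0 o2 = injZ z2 -> on_scale (fun M e => inj0 (g M e)) (C + C) w z2 ->
  exists2 z, on_scale (fun M e => inj0 (g M e)) (C + C) (inversion_wt a w l) z &
    val (foldl (@monoid.mul (Un S n.+3)) P (map pair_mx l)) o0 o2 = injZ z.
Proof.
have gP0 := maxplus_scale_inj0 gP.
elim: l a w z1 z2 P => [|j l IHl] a w z1 z2 P /=; first by exists z2.
case/andP=> jk lk P01 z1a P02 z2w.
have [|||Q01 Q02] := Un_mul_entries (B := pair_mx j) (b01 := inj0 (g C j))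
  (b12 := inj0 (g C (k - j))) (b02 := inj0 (g (C + C) 0)) P01 P02.
- by rewrite mxE.
- by rewrite mxE.
- by rewrite mxE.
apply: IHl lk Q01 _ Q02 _; first by apply: (on_scaleD gP0) => //; split=> //; lia.
apply: (on_scaleD gP0).
  by rewrite -[w]maxn0; apply: (on_scaleD gP0) => //; split=> //; lia.
by apply: (on_scaleM gP0) => //; split=> //; lia.
Qed.

End UnitriangularMatrices.

Lemma Un_not_strongly_permutable (S : bareSemiringType) n :
  bipotent S -> unbounded_mul_order S ->
  ~ strongly_permutable (Un S n.+3).
Proof.
move=> bipS ordS.
pose o2 : 'I_n.+3 := Ordinal (isT : 2 < n.+3).
apply: (@not_strongly_permutable _ _ (fun A : Un S n.+3 => val A ord0 o2)) => k0.
set k := k0.+2; pose C := k.+1.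
have [g gP] := maxplus_scale_exists (C + C) bipS ordS.
pose s : nat -> Un S n.+3 := @pair_mx k S g n C.
have prodP i l : all (gtn k) (i :: l) ->
    exists2 z, on_scale (fun M e => inj0 (g M e)) (C + C) (inversion_wt k i 0 l) z &
      val (seq_prod s (i :: l)) ord0 o2 = inj1 z.
  case/andP=> ik lk.
  apply: (pair_mx_prod gP (ltnSn k) (z1 := inj0 (g C i)) (z2 := inj0 (g (C + C) 0)) lk).
  - by rewrite mxE.
  - by split=> //; apply: leq_trans ik _; lia.
  - by rewrite mxE.
  - by split.
exists s => l l_iota eq_prod.
have size_l : size l = k by rewrite (perm_size l_iota) size_iota.
have lk := perm_iota_lt l_iota.
apply: (sorted_eq ltn_trans) l_iota.
- by move=> x y /andP[]; lia.
- case: l size_l eq_prod lk => // i l _ eq_prod lk.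
  have iotak := perm_iota_lt (perm_refl (iota 0 k)).
  have [z il zE] := prodP _ _ lk; have [z' ij zE'] := prodP 0 (iota 1 k0.+1) iotak.
  have zz : z = z' by apply: inj1_inj; rewrite -zE -zE' -eq_prod.
  rewrite -{}zz in ij; have wt_il := on_scale_inj (maxplus_scale_inj0 gP) (leqnn _) il ij.
  case/andP: iotak lk => _ iotak /andP[ik lk].
  have : (inversion_wt k i 0 l <= k.-1)%N.
    by rewrite wt_il inversion_wt_le //; apply: (iota_ltn_sorted 0 k).
  by rewrite inversion_wt_le.
- exact: iota_ltn_sorted.
Qed.

Lemma commutative_strongly_permutable (T : semigroupType) :
  commutative (@monoid.mul T) -> strongly_permutable T.
Proof.
move=> mulC; exists 0 => s; exists (tperm ord0 ord_max).
  by apply/eqP => /permP/(_ ord0); rewrite tpermL perm1.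
have enum2 : enum 'I_2 = [:: ord0; ord_max].
  by apply: (inj_map val_inj); rewrite val_enum_ord.
by rewrite /ord_prod enum2 /= tpermL tpermR mulC.
Qed.

(** A product of two strictly upper triangular parts vanishes, as it needs
three increasing indices; multiplication of the matrices is then addition of
these parts, which is commutative. *)
Lemma Un_le2_strongly_permutable (S : bareSemiringType) n :
  (n <= 2)%N -> strongly_permutable (Un S n).
Proof.
move=> n2; apply: commutative_strongly_permutable => A B; apply: val_inj => /=.
case: A B => [A UA] [B UB] /=.
have /is_UnP[a hA ha] := UA; have /is_UnP[b hB hb] := UB.
apply/matrixP => i j; rewrite !mxE (Un_entryE hA ha hB hb) (Un_entryE hB hb hA ha) /=.
have star0 c d :
    (forall i j : 'I_n, if (i < j)%N then in_S (c i j) else c i j = zero0 S) ->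
    (forall i j : 'I_n, if (i < j)%N then in_S (d i j) else d i j = zero0 S) ->
    star c d i j = add0 (c i j) (d i j).
  move=> hc hd; rewrite /star big1 ?Monoid.mulm1 // => t _.
  have := hc i t; case: ltnP => [it _|_ ->]; last exact: mul0z.
  have := hd t j; case: ltnP => [tj _|_ ->]; last exact: mulz0.
  by have := ltn_ord j; lia.
by rewrite !star0 // add0C.
Qed.

Theorem theorem3p6 (S : bareSemiringType) (hbip : bipotent S)
    (hord : unbounded_mul_order S) :
  (forall n : nat, (2 <= n)%N ->
     ~ strongly_permutable (Mn S n) /\ ~ strongly_permutable (UT S n)) /\
  (forall n : nat, (1 <= n)%N ->
     (~ strongly_permutable (Un S n) <-> (3 <= n)%N)).
Proof.
split=> [[|[|n]] // _|n _].
  by split; [apply: Mn_not_strongly_permutable | apply: UT_not_strongly_permutable].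
split=> [not_sp|]; last by case: n => [|[|[|n]]] // _; apply: Un_not_strongly_permutable.
by rewrite ltnNge; apply/negP => /(Un_le2_strongly_permutable S).
Qed.
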